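(* There are infinitely many connected graphs $G$ for which $\delta(G)=2$, $\Delta(G)=5$, and the inequality $$\frac{M_1(G)}{n(G)}>\frac{M_2(G)}{m(G)}$$ holds.
   Context: All graphs are finite, simple, non-null and have no isolated vertices. For a graph $G$ with vertex set $V(G)$ and edge set $E(G)$: $n(G)=|V(G)|$ is the order, $m(G)=|E(G)|$ is the size, $d_G(u)$ is the degree of a vertex $u$, and $\Delta(G)$ and $\delta(G)$ are the maximum and minimum degrees. The first and second Zagreb indices are $M_1(G)=\sum_{v\in V(G)}d_G(v)^2$ and $M_2(G)=\sum_{uv\in E(G)}d_G(u)d_G(v)$. ''Infinitely many'' is understood up to isomorphism. *)

(* Defs.v *)
From mathcomp Require Import all_boot.

Set Implicit Arguments.
Unset Strict Implicit.
Unset Printing Implicit Defensive.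

Record sgraph := SGraph {
  vertex :> finType;
  adj : rel vertex;
  adj_sym : symmetric adj;
  adj_irrefl : irreflexive adj;
  graph_nonnull : 0 < #|vertex|;
  graph_no_isolated : forall u : vertex, exists v : vertex, adj u v
}.

Definition isomorphic (G H : sgraph) : Prop :=
  exists2 f : G -> H, bijective f & {mono f : u v / adj u v}.

Definition edges (G : sgraph) : {set {set G}} :=
  [set [set p.1; p.2] | p : G * G & adj p.1 p.2].

Definition graph_order (G : sgraph) : nat := #|G|.

Definition graph_size (G : sgraph) : nat := #|edges G|.

Definition degree (G : sgraph) (u : G) : nat := #|[set v | adj u v]|.

Definition max_degree (G : sgraph) : nat := \max_(u : G) degree u.

(* The default value [graph_order G] exceeds every degree, so on a nonempty
   vertex set this is the minimum of the degrees. *)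
Definition min_degree (G : sgraph) : nat :=
  \big[minn/graph_order G]_(u : G) degree u.

Definition connected (G : sgraph) : Prop :=
  forall u v : G, connect (@adj G) u v.

Definition zagreb1 (G : sgraph) : nat := \sum_(v : G) degree v ^ 2.

(* An edge e = {u, v} has exactly two elements, so the product over e is
   d(u) d(v). *)
Definition zagreb2 (G : sgraph) : nat :=
  \sum_(e in edges G) \prod_(u in e) degree u.

(* Infinitely many up to isomorphism: a sequence of pairwise non-isomorphic
   graphs satisfying P. *)
Definition infinitely_many (P : sgraph -> Prop) : Prop :=
  exists2 G : nat -> sgraph,
    forall i, P (G i) & forall i j, isomorphic (G i) (G j) -> i = j.

(* Main.v *)
(** The excess [M1 m - M2 n] vanishes on graphs all of whose edges join degrees 2
    and 5 and on cubic graphs, but on a disjoint union of the two kinds the cross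
    term is positive. It grows like the product of the two orders, whereas
    joining the two parts by two edges costs only a linear amount. Close up into
    a ring a (2,5)-chain on 29 vertices and [k] cubic diamonds (K4 minus an
    edge): the order is [29 + 4 k], the size [41 + 6 k], [M1 = 284 + 36 k] and
    [M2 = 403 + 54 k], so the excess is [2 k - 43]. *)

Require Import Defs.
From mathcomp Require Import all_boot all_order all_algebra.
From mathcomp Require Import zify.
Import Order.TTheory GRing.Theory Num.Theory.

(** * Minima and double counting over arcs *)

Lemma bigminn_leq (I : finType) (F : I -> nat) (c : nat) (i : I) :
  \big[minn/c]_(j : I) F j <= F i.
Proof.
have: i \in index_enum I by rewrite mem_index_enum.
elim: (index_enum I) => // j s IHs; rewrite in_cons big_cons.
case/predU1P=> [<- | /IHs]; first exact: geq_minl.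
by apply: leq_trans; exact: geq_minr.
Qed.

(** Each edge comes from exactly two arcs, [(u, v)] and [(v, u)], distinct as there are no loops.
    Constant [F] gives the handshake lemma, the product of the degrees gives the second Zagreb
    index. *)
Lemma sum_arcs (G : sgraph) (F : {set G} -> nat) :
  \sum_(u : G) \sum_(v | adj u v) F [set u; v] = 2 * \sum_(e in edges G) F e.
Proof.
rewrite pair_big_dep /=.
rewrite (partition_big_imset (fun p : G * G => [set p.1; p.2])) /=.
have edgesE : [set [set p.1; p.2] | p : G * G & adj p.1 p.2] = edges G by [].
rewrite [LHS](_ : _ = \sum_(e in edges G)
    \sum_(p : G * G | adj p.1 p.2 && ([set p.1; p.2] == e)) F e); last first.
  rewrite [LHS](eq_bigl (mem (edges G))) => [|e].
    by apply: eq_bigr => e _; apply: eq_bigr => p /andP[_ /eqP->].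
  rewrite -edgesE.
  by apply/imsetP/imsetP => -[p]; rewrite ?inE => pA ->; exists p; rewrite ?inE.
rewrite big_distrr /=; apply: eq_bigr => e /imsetP[[u v]]; rewrite inE /= => uv ->.
rewrite sum_nat_const; congr (_ * _).
have neq_uv : u != v by apply: contraTneq uv => ->; rewrite adj_irrefl.
transitivity #|[set (u, v); (v, u)]|; last first.
  by rewrite cards2 xpair_eqE negb_and neq_uv.
apply: eq_card => -[x y]; rewrite !inE !xpair_eqE /=.
apply/andP/orP=> [[xy /eqP/setP eq_xy] | [] /andP[/eqP-> /eqP->]]; last first.
- by rewrite adj_sym uv setUC.
- by rewrite uv.
apply/orP; have neq_xy : x != y by apply: contraTneq xy => ->; rewrite adj_irrefl.
have := eq_xy x; have := eq_xy y; rewrite !inE !eqxx orbT /= => /esym yE /esym xE.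
by case/pred2P: xE neq_xy => ->; case/pred2P: yE => ->; rewrite !eqxx ?orbT.
Qed.

Lemma sum_degree (G : sgraph) : \sum_(u : G) degree u = 2 * graph_size G.
Proof.
rewrite /graph_size -sum1_card -sum_arcs; apply: eq_bigr => u _.
by rewrite sum1dep_card.
Qed.

Lemma sum_degree_neighbours (G : sgraph) :
  \sum_(u : G) degree u * \sum_(v | adj u v) degree v = 2 * zagreb2 G.
Proof.
rewrite /zagreb2 -sum_arcs; apply: eq_bigr => u _.
rewrite big_distrr; apply: eq_bigr => v uv /=.
rewrite big_setU1 ?big_set1 // inE.
by apply: contraTneq uv => ->; rewrite adj_irrefl.
Qed.

(** * Neighbour lists of the ring *)

(* Vertex 0 has degree 2; the block of 7 vertices from [b = 1 + 7 j], j < 4, is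
   a hub [b], four vertices of degree 2 joined to [b] and [b + 5], the hub
   [b + 5], and a vertex [b + 6] of degree 2 leading on. The diamond on
   [b, ..., b + 3], with [b = 29 + 4 i] and i < n, lacks the edge from [b] to
   [b + 3]; the last diamond is joined back to 0. *)
Definition nbr (n x : nat) : seq nat :=
  if x == 0 then [:: 1; 28 + 4 * n]
  else if x < 29 then
    let r := x.-1 %% 7 in let b := x - r in
    match r with
    | 0 => [:: b - 1; b + 1; b + 2; b + 3; b + 4]
    | 5 => [:: b + 1; b + 2; b + 3; b + 4; b + 6]
    | 6 => [:: b + 5; b + 7]
    | _ => [:: b; b + 5]
    end
  else
    let r := (x - 29) %% 4 in let b := x - r in
    match r with
    | 0 => [:: b - 1; b + 1; b + 2]
    | 1 => [:: b; b + 2; b + 3]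
    | 2 => [:: b; b + 1; b + 3]
    | _ => [:: b + 1; b + 2; if b + 4 == 29 + 4 * n then 0 else b + 4]
    end.

(** The intended degrees: the list covers the vertices below 29, the default 3 every diamond
    vertex. *)
Definition dg (x : nat) : nat :=
  nth 3 (2 :: flatten (nseq 4 [:: 5; 2; 2; 2; 2; 5; 2])) x.

(* On 1, ..., 28 the list [nbr n x] does not depend on [n], which makes these
   vertices accessible to computation. *)
Variant vertex_spec (n : nat) : nat -> seq nat -> Type :=
| VFirst : vertex_spec n 0 [:: 1; 28 + 4 * n]
| VChain x of 0 < x < 29 : vertex_spec n x (nbr 0 x)
| VDiamond0 i of i < n :
    vertex_spec n (29 + 4 * i) [:: 28 + 4 * i; 30 + 4 * i; 31 + 4 * i]
| VDiamond1 i of i < n :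
    vertex_spec n (30 + 4 * i) [:: 29 + 4 * i; 31 + 4 * i; 32 + 4 * i]
| VDiamond2 i of i < n :
    vertex_spec n (31 + 4 * i) [:: 29 + 4 * i; 30 + 4 * i; 32 + 4 * i]
| VDiamond3 i of i.+1 < n :
    vertex_spec n (32 + 4 * i) [:: 30 + 4 * i; 31 + 4 * i; 33 + 4 * i]
| VLast i of n = i.+1 :
    vertex_spec n (32 + 4 * i) [:: 30 + 4 * i; 31 + 4 * i; 0].

Lemma nbr_diamond n i a : a < 4 -> nbr n (29 + 4 * i + a) =
  nth [::] [:: [:: 28 + 4 * i; 30 + 4 * i; 31 + 4 * i];
               [:: 29 + 4 * i; 31 + 4 * i; 32 + 4 * i];
               [:: 29 + 4 * i; 30 + 4 * i; 32 + 4 * i];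
               [:: 30 + 4 * i; 31 + 4 * i;
                   if i.+1 == n then 0 else 33 + 4 * i]] a.
Proof.
move=> a4; rewrite /nbr.
have -> : (29 + 4 * i + a == 0) = false by lia.
have -> : (29 + 4 * i + a < 29) = false by lia.
have -> : (29 + 4 * i + a - 29) %% 4 = a by lia.
have -> : 29 + 4 * i + a - a = 29 + 4 * i by lia.
case: a a4 => [|[|[|[|//]]]] _ /=.
- by congr [:: _; _; _]; lia.
- by congr [:: _; _; _]; lia.
- by congr [:: _; _; _]; lia.
have -> : (29 + 4 * i + 4 == 29 + 4 * n) = (i.+1 == n) by lia.
by case: (i.+1 == n); congr [:: _; _; _]; lia.
Qed.

Lemma vertexP n x : x < 29 + 4 * n -> vertex_spec n x (nbr n x).
Proof.
case: (posnP x) => [-> _ | x_gt0]; first exact: VFirst.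
case: (ltnP x 29) => [x_lt | x_ge] xn.
  rewrite (_ : nbr n x = nbr 0 x); first by apply: VChain; rewrite x_gt0.
  by rewrite /nbr (gtn_eqF x_gt0) x_lt.
pose i := (x - 29) %/ 4; pose a := (x - 29) %% 4.
have a4 : a < 4 by rewrite ltn_mod.
have in_n : i < n by rewrite /i; lia.
have -> : x = 29 + 4 * i + a by rewrite /i /a; lia.
rewrite nbr_diamond //; case: a a4 => [|[|[|[|//]]]] _ /=.
- by rewrite addn0; exact: VDiamond0.
- by rewrite addn1; exact: VDiamond1.
- by rewrite addn2; exact: VDiamond2.
rewrite addn3; case: eqP => [ni | /eqP ni].
  by apply: VLast.
by apply: VDiamond3; lia.
Qed.

(** Reduces a claim about the chain to a boolean test on 28 values, settled by evaluation. *)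
Lemma chainP (P : nat -> bool) :
  all P (iota 1 28) -> forall x, 0 < x < 29 -> P x.
Proof. by move=> /allP Pall x ?; apply: Pall; rewrite mem_iota. Qed.

Lemma dg_diamond x : 29 <= x -> dg x = 3.
Proof. by move=> x_ge; rewrite /dg nth_default. Qed.

Lemma size_nbr n x : x < 29 + 4 * n -> size (nbr n x) = dg x.
Proof.
case/vertexP => [|z z_in|i _|i _|i _|i _|i _] //; try by rewrite dg_diamond.
by apply/eqP; move: z z_in; exact: chainP.
Qed.

Lemma uniq_nbr n x : 0 < n -> x < 29 + 4 * n -> uniq (nbr n x).
Proof.
move=> n_gt0; case/vertexP => [|z|i|i|i|i|i]; try by rewrite /= ?inE; lia.
by move: z; exact: chainP.
Qed.

Lemma nbr_lt n x : 0 < n -> x < 29 + 4 * n -> all (gtn (29 + 4 * n)) (nbr n x).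
Proof.
move=> n_gt0; case/vertexP => [|z z_in|i|i|i|i|i]; try by rewrite /=; lia.
(* The largest neighbour of a chain vertex is 29, which is a vertex because [0 < n]. *)
apply: (@sub_all _ (gtn 30)) => [y /=|]; first by lia.
by move: z z_in; exact: chainP.
Qed.

Lemma nbr_sym n x y : 0 < n -> x < 29 + 4 * n -> y \in nbr n x -> x \in nbr n y.
Proof.
move=> n_gt0 x_lt yx; have y_lt := allP (nbr_lt n x n_gt0 x_lt) y yx.
(* The last two clauses record that the chain has only two exits, from 1 to 0 and from 28 to 29. *)
have chainE z : 0 < z < 29 -> all (fun t =>
    [&& t < 30, z \in nbr 0 t, (t == 0) ==> (z == 1) & (t == 29) ==> (z == 28)])
    (nbr 0 z).
  by move: z; exact: chainP.
move: x_lt yx; rewrite /= in y_lt; case/vertexP=> [|z z_in|i ?|i ?|i ?|i ?|i ?].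
all: case/vertexP: y_lt => [|t t_in|j ?|j ?|j ?|j ?|j ?].
all: try by rewrite ?inE; lia.
all: try by move/(allP (chainE z z_in))=> /and4P[]; rewrite ?inE; lia.
all: rewrite !inE => *; have : t = 1 \/ t = 28 by lia.
all: by case=> ?; subst t; rewrite !inE; lia.
Qed.

Lemma dg_bounds x : 2 <= dg x <= 5.
Proof.
case: (ltnP x 29) => [x_lt | x_ge]; last by rewrite dg_diamond.
case: (posnP x) => [-> // | x_gt0].
by apply: (@chainP (fun y => 2 <= dg y <= 5)); rewrite // x_gt0.
Qed.

(** Repeated descent leads every vertex to 0; connectedness rests on this. *)
Lemma nbr_smaller n x : 0 < x < 29 + 4 * n -> has (gtn x) (nbr n x).
Proof.
case/andP=> + x_lt; case/vertexP: x_lt => [|z z_in|i ?|i ?|i ?|i ?|i ?] //= _.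
  by move: z z_in; exact: chainP.
all: lia.
Qed.

(** * Degree sums along the ring *)

(** The summand of [sum_degree_neighbours], whose total is twice the second Zagreb index. *)
Definition weight (n x : nat) : nat := dg x * \sum_(y <- nbr n x) dg y.

(** Three neighbours of degree 3 give 27; each end of the string of diamonds has one neighbour of
    degree 2 instead, hence 24. *)
Lemma weight_diamond n x : 29 <= x < 29 + 4 * n ->
  weight n x = if (x == 29) || (x == 28 + 4 * n) then 24 else 27.
Proof.
case/andP=> x_ge x_lt; rewrite /weight dg_diamond //; move: x_ge.
case/vertexP: x_lt => [|z|[|i] ?|i ?|i ?|i ?|i ?] // x_ge; try by lia.
  by rewrite unlock.
1-4: by rewrite !big_cons big_nil !dg_diamond; try lia; case: ifP; lia.
by rewrite !big_cons big_nil !(dg_diamond (_ + _)) ?ifT //; lia.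
Qed.

Lemma sum_chain (F : nat -> nat) n :
  \sum_(x < 29 + n) F x = \sum_(x <- iota 0 29) F x + \sum_(x < n) F (29 + x).
Proof. by rewrite big_split_ord /= -(big_mkord predT). Qed.

Lemma sum_dg n : \sum_(x < 29 + 4 * n) dg x = 82 + 12 * n.
Proof.
rewrite sum_chain; under [in X in _ + X]eq_bigr do rewrite dg_diamond ?leq_addr //.
rewrite sum_nat_const card_ord (_ : \sum_(x <- iota 0 29) _ = 82); first lia.
by rewrite unlock.
Qed.

Lemma sum_dg2 n : \sum_(x < 29 + 4 * n) dg x ^ 2 = 284 + 36 * n.
Proof.
rewrite (sum_chain (fun x => dg x ^ 2)).
under [in X in _ + X]eq_bigr do rewrite dg_diamond ?leq_addr //.
rewrite sum_nat_const card_ord (_ : \sum_(x <- iota 0 29) _ = 284); first lia.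
by rewrite unlock.
Qed.

Lemma sum_weight n : 0 < n ->
  \sum_(x < 29 + 4 * n) weight n x = 806 + 108 * n.
Proof.
case: n => // k _; rewrite sum_chain.
(* The 8 hubs contribute 50 each, 0 and 28 contribute 16 each because of a diamond neighbour, and
   the other 19 vertices of degree 2 contribute 20 each. *)
have -> : \sum_(x <- iota 0 29) weight k.+1 x = 812.
  have w0 : weight k.+1 0 = 16.
    by rewrite /weight !big_cons big_nil (@dg_diamond (_ + _)) //; lia.
  by rewrite big_cons w0 /weight unlock.
set F := fun x => weight k.+1 (29 + x).
have -> : \sum_(x < 4 * k.+1) weight k.+1 (29 + x) = \sum_(x < (4 * k).+4) F x.
  by rewrite -!(big_mkord predT F); congr bigop; rewrite /index_iota; congr iota; lia.
(* Splits off the first and last diamond vertices, the two of weight 24. *)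
rewrite big_ord_recl big_ord_recr /= (eq_bigr (fun _ => 27)) => [|x _].
  by rewrite sum_nat_const card_ord /F !weight_diamond ?ifT /= /bump; lia.
by rewrite /F weight_diamond ?ifF //= /bump; case: x => /=; lia.
Qed.

(** * The necklace graphs and their invariants *)

Section Necklace.

Variable k : nat.

(** A successor, so that [0 < n] holds by computation. *)
Let n := k.+1.
Let N := 29 + 4 * n.

Definition necklace_adj : rel 'I_N := fun x y => (y : nat) \in nbr n x.

Lemma necklace_sym : symmetric necklace_adj.
Proof.
by move=> x y; apply/idP/idP; rewrite /necklace_adj; apply: nbr_sym.
Qed.

Lemma necklace_irrefl : irreflexive necklace_adj.
Proof.
move=> [x x_lt]; apply/negbTE; rewrite /necklace_adj /=.
move: x_lt; case/vertexP=> [|z|i|i|i|i|i]; try by rewrite !inE; lia.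
by move: z; exact: chainP.
Qed.

Lemma necklace_nonnull : 0 < #|'I_N|.
Proof. by rewrite card_ord. Qed.

(** By [uniq_nbr] and [nbr_lt] the list enumerates the neighbourhood, which carries list
    computations over to the graph. *)
Lemma necklace_sum (x : 'I_N) (F : nat -> nat) :
  \sum_(y : 'I_N | necklace_adj x y) F y = \sum_(y <- nbr n x) F y.
Proof.
rewrite -(big_mkord (mem (nbr n x))) -big_filter; apply/perm_big/uniq_perm.
- by rewrite filter_uniq ?iota_uniq.
- exact: uniq_nbr.
move=> y; rewrite mem_filter mem_iota subn0 add0n /=.
by apply: andb_idr => /(allP (nbr_lt n x isT (ltn_ord x))).
Qed.

Lemma necklace_card_adj (x : 'I_N) : #|[set y | necklace_adj x y]| = dg x.
Proof.
rewrite -sum1dep_card (necklace_sum x (fun _ => 1)) sum1_size.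
exact: size_nbr.
Qed.

Lemma necklace_no_isolated (x : 'I_N) : exists y, necklace_adj x y.
Proof.
have /card_gt0P[y] : 0 < #|[set y | necklace_adj x y]|.
  by rewrite necklace_card_adj; case/andP: (dg_bounds x) => /ltnW.
by rewrite inE; exists y.
Qed.

Definition necklace : sgraph :=
  SGraph necklace_sym necklace_irrefl necklace_nonnull necklace_no_isolated.

Lemma necklace_degree (x : necklace) : degree x = dg (x : 'I_N).
Proof. exact: necklace_card_adj. Qed.

Lemma necklace_connected : connected necklace.
Proof.
have to0 m (lt_m : m < N) : connect necklace_adj (Ordinal lt_m) ord0.
  elim/ltn_ind: m lt_m => m IHm lt_m.
  have [m0 | m_gt0] := posnP m.
    by rewrite (_ : Ordinal _ = ord0) //; exact: val_inj.
  have /hasP[y my /= lt_y] : has (gtn m) (nbr n m).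
    by apply: nbr_smaller; rewrite m_gt0.
  apply: connect_trans (IHm y lt_y (ltn_trans lt_y lt_m)).
  exact: connect1.
move=> [u lt_u] [v lt_v]; apply: connect_trans (to0 u lt_u) _.
by rewrite (sym_connect_sym necklace_sym); exact: to0.
Qed.

Lemma necklace_max_degree : max_degree necklace = 5.
Proof.
apply/eqP; rewrite eqn_leq; apply/andP; split.
  apply/bigmax_leqP => x _; rewrite necklace_degree.
  by case/andP: (dg_bounds (x : 'I_N)).
(* Vertex 1 is the first hub, of degree 5. *)
have lt1 : 1 < N by [].
by rewrite -[5](necklace_degree (Ordinal lt1)); exact: leq_bigmax.
Qed.

Lemma necklace_min_degree : min_degree necklace = 2.
Proof.
apply/eqP; rewrite eqn_leq; apply/andP; split.
  by rewrite -[2](necklace_degree (ord0 : 'I_N)); exact: bigminn_leq.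
(* The default value of the minimum, the order, has to be at least 2 as well. *)
apply: (big_ind (leq 2)) => [|a b a2 b2|x _].
- by rewrite /graph_order card_ord.
- by rewrite leq_min a2.
by rewrite necklace_degree; case/andP: (dg_bounds (x : 'I_N)).
Qed.

Lemma necklace_order : graph_order necklace = 29 + 4 * n.
Proof. exact: card_ord. Qed.

Lemma necklace_size : graph_size necklace = 41 + 6 * n.
Proof.
have := sum_degree necklace; rewrite (eq_bigr _ (fun x _ => necklace_degree x)).
by rewrite sum_dg; lia.
Qed.

Lemma necklace_zagreb1 : zagreb1 necklace = 284 + 36 * n.
Proof.
rewrite -sum_dg2; apply: eq_bigr => x _.
by rewrite necklace_degree.
Qed.

Lemma necklace_zagreb2 : zagreb2 necklace = 403 + 54 * n.
Proof.
have := sum_degree_neighbours necklace.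
rewrite (eq_bigr (fun x : 'I_N => weight n x)) => [|x _].
  by rewrite sum_weight //; lia.
rewrite necklace_degree; congr (_ * _); rewrite -necklace_sum.
by apply: eq_bigr => y _; rewrite necklace_degree.
Qed.

End Necklace.

(** * Comparison of the two ratios *)

Local Open Scope ring_scope.

Lemma ltr_nat_ratio (R : numFieldType) (a b c d : nat) :
  (0 < b)%N -> (0 < d)%N ->
  (a%:R / b%:R < c%:R / d%:R :> R) = (a * d < c * b)%N.
Proof.
move=> b_gt0 d_gt0; rewrite ltr_pdivrMr ?ltr0n // mulrAC ltr_pdivlMr ?ltr0n //.
by rewrite -!natrM ltr_nat.
Qed.

Theorem proposition2p4 :
  infinitely_many (fun G : sgraph =>
    [/\ connected G, min_degree G = 2%N, max_degree G = 5%N &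
        (zagreb1 G)%:R / (graph_order G)%:R >
        (zagreb2 G)%:R / (graph_size G)%:R :> rat]).
Proof.
(* [necklace (21 + i)] has [22 + i] diamonds, and 22 is the least number of diamonds with positive
   excess. *)
exists (fun i => necklace (21 + i)) => [i | i j [f f_bij _]].
  split; [exact: necklace_connected | exact: necklace_min_degree
         | exact: necklace_max_degree |].
  rewrite necklace_order necklace_size necklace_zagreb1 necklace_zagreb2.
  by rewrite ltr_nat_ratio; lia.
(* Isomorphic graphs have the same order, which determines the number of diamonds. *)
have := bij_eq_card f_bij; rewrite -!/(graph_order _) !necklace_order.
by lia.
Qed.
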